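(* Let $(\rho_h^n,m_h^n)_{n\ge0}$ be a solution of the fully discrete problem (D) defined in the context, with time step $\tau>0$ and initial values $\rho_{0,h},m_{0,h}$. Then for all $n\ge0$ $$\int_{\mathcal E}\rho_h^n\,dx=\int_{\mathcal E}\rho_{0,h}\,dx$$ and $$\int_{\mathcal E}\Big(\frac{|m_h^n|^2}{2\rho_h^n}+P(\rho_h^n)\Big)dx+\tau\sum_{k=1}^n\int_{\mathcal E}\Big(a\frac{|\partial_x'm_h^k|^2}{|\rho_h^k|^2}+b\frac{|m_h^k|^3}{|\rho_h^k|^2}\Big)dx\le\int_{\mathcal E}\Big(\frac{m_{0,h}^2}{2\rho_{0,h}}+P(\rho_{0,h})\Big)dx.$$
   Context: Network. $\mathcal G=(\mathcal V,\mathcal E,\ell)$ is a finite, directed, connected graph with vertex set $\mathcal V$, edge set $\mathcal E\subset\mathcal V\times\mathcal V$, and lengths $\ell_e>0$, $e\in\mathcal E$. An edge $e=(v_1,v_2)$ is identified with the interval $[0,\ell_e]$ ($v_1$ corresponding to $0$, $v_2$ to $\ell_e$), and $n_e(v_1)=-1$, $n_e(v_2)=1$. $\mathcal E(v)$ is the set of edges incident on $v$. For a function $u$ on the network, $u_e=u|_e$, and $u_e(v)$ is its value at the endpoint $v$. $L^2(\mathcal E)$ and $H^1(\mathcal E)$ are the spaces of functions with $u_e\in L^2(e)$, resp. $H^1(e)$, for every $e$ (no continuity at vertices); $(u,v)_{\mathcal E}=\sum_{e}\int_0^{\ell_e}u_ev_e\,dx$, $\int_{\mathcal E}u\,dx=\sum_e\int_0^{\ell_e}u_e\,dx$;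 $(\partial_x'u)|_e=\partial_x(u_e)$. $H_0(\mathrm{div})=\{m\in H^1(\mathcal E):\sum_{e\in\mathcal E(v)}m_e(v)n_e(v)=0\ \forall v\in\mathcal V\}$. Data. $a_e,b_e\ge0$, $c_e>0$ are constants on each edge, $a,b$ the edgewise constant functions with values $a_e,b_e$; $\gamma>1$; $P_e(\rho)=\frac{c_e}{\gamma-1}\rho^\gamma$; $P(\rho),P'(\rho)$ have restrictions $P_e(\rho_e),P_e'(\rho_e)$ to $e$. Finite element spaces. $T_h(e)$ is a uniform mesh of $[0,\ell_e]$ into finitely many subintervals $K$, and $T_h(\mathcal E)$ is the collection of these meshes. $P_k(T_h(\mathcal E))$ is the space of functions in $L^2(\mathcal E)$ that are polynomials of degree $\le k$ on every element $K$. $V_h=P_1(T_h(\mathcal E))\cap H_0(\mathrm{div})$ and $Q_h=P_0(T_h(\mathcal E))$. Fully discrete problem (D): let $\tau>0$, and for a sequence $(d^n)_{n\ge0}$ let $\bar\partial_\tau d^n=\frac{d^n-d^{n-1}}{\tau}$, $n\ge1$. Given $\rho_{0,h}\in Q_h$ with $\rho_{0,h}>0$ and $m_{0,h}\in V_h$, set $\rho_h^0=\rho_{0,h}$, $m_h^0=m_{0,h}$, and for $n\ge1$ find $(\rho_h^n,m_h^n)\in Q_h\times V_h$ with $\rho_h^n>0$ such that for all $q_h\in Q_h$ and $v_h\in V_h$ \begin{align*} (\bar\partial_\tau\rho_h^n,q_h)_{\mathcal E}&=-(\partial_x'm_h^n,q_h)_{\mathcal E},\\ \Big(\tfrac1{\rho_h^{n-1}}\bar\partial_\tau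 m_h^n-\tfrac{m_h^n}{2|\rho_h^n|^2}\bar\partial_\tau\rho_h^n,v_h\Big)_{\mathcal E}&=\Big(\tfrac{|m_h^n|^2}{2|\rho_h^n|^2}+P'(\rho_h^n)-\tfrac{a}{|\rho_h^n|^2}\partial_x'm_h^n,\partial_x'v_h\Big)_{\mathcal E}\\ &\quad-\Big(\tfrac{m_h^n}{2|\rho_h^n|^2}\partial_x'm_h^n,v_h\Big)_{\mathcal E}-\Big(b\tfrac{|m_h^n|m_h^n}{|\rho_h^n|^2},v_h\Big)_{\mathcal E}. \end{align*} *)

(* Defs.v *)
From mathcomp Require Import all_boot all_order all_algebra.
From mathcomp Require Import all_classical all_reals all_analysis.

Set Implicit Arguments.
Unset Strict Implicit.
Unset Printing Implicit Defensive.

Import Order.TTheory GRing.Theory Num.Theory.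
Import numFieldNormedType.Exports.

Local Open Scope classical_set_scope.
Local Open Scope ring_scope.

(* Connectedness is that of the underlying undirected graph. *)
Record network (R : realType) := Network {
  vertex : finType;
  edges : {set vertex * vertex};
  len : vertex * vertex -> R;
  len_gt0 : forall e, e \in edges -> 0 < len e;
  network_connected : forall v w : vertex,
    connect (fun x y => ((x, y) \in edges) || ((y, x) \in edges)) v w }.

(* The edge e is [0, len e], with e.1 at 0 and e.2 at [len e].  Values at
   e \notin edges G or outside [0, len e] are never used. *)
Definition netfun (R : realType) (G : network R) : Type :=
  vertex G * vertex G -> R -> R.

Section FunctionSpaces.
Context {R : realType}.
Implicit Types (l : R) (u g phi : R -> R).

Definition L2 l u : Prop :=
  (u \_ `[0, l]) \in Lfun (@lebesgue_measure R) 2%:E.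

(* C_c^oo(]0, l[) *)
Definition test_function l phi : Prop :=
  (forall n x, derivable (derive1n n phi) x 1) /\
  exists s t, [/\ 0 < s, t < l & forall x, x \notin `[s, t] -> phi x = 0].

Definition weak_derivative l u g : Prop :=
  forall phi, test_function l phi ->
    \int[lebesgue_measure]_(x in `[0, l]) (u x * derive1 phi x) =
    - \int[lebesgue_measure]_(x in `[0, l]) (g x * phi x).

(* An element of H^1 is given by its continuous representative on [0, l], so
   that its values at the end points are its traces. *)
Definition H1 l u : Prop :=
  [/\ L2 l u, {within `[0, l], continuous u} &
      exists2 g, L2 l g & weak_derivative l u g].

End FunctionSpaces.

Section Network.
Context {R : realType} (G : network R).
Implicit Types u v m : netfun G.

Definition intE u : R :=
  \sum_(e in edges G) \int[lebesgue_measure]_(x in `[0, len e]) u e x.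

Definition ipE u v : R := intE (fun e x => u e x * v e x).

(* On H^1 the classical derivative exists a.e. and is the weak derivative; its
   default value elsewhere does not affect the integrals. *)
Definition dx u : netfun G := fun e => derive1 (u e).

Definition L2E u : Prop := forall e, e \in edges G -> L2 (len e) (u e).

Definition H1E u : Prop := forall e, e \in edges G -> H1 (len e) (u e).

(* Summing m_e(v) n_e(v) over the end points of edges lying at v: n_e = 1 at the
   head e.2 and n_e = -1 at the tail e.1.  A loop counts once for each end. *)
Definition H0div m : Prop :=
  H1E m /\ forall v : vertex G,
    \sum_(e in edges G | e.2 == v) m e (len e)
      - \sum_(e in edges G | e.1 == v) m e 0 = 0.

(* A uniform mesh of each edge, determined by its number of elements. *)
Record mesh := Mesh {
  nelt : vertex G * vertex G -> nat;
  nelt_gt0 : forall e, e \in edges G -> (0 < nelt e)%N }.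

Variable T : mesh.

Definition node (e : vertex G * vertex G) (i : nat) : R :=
  i%:R * (len e / (nelt T e)%:R).

(* Elements are open, since a piecewise polynomial is only defined up to its
   values at the nodes. *)
Definition element (e : vertex G * vertex G) (i : nat) : set R :=
  `]node e i, node e i.+1[.

Definition Pk (k : nat) u : Prop :=
  L2E u /\ forall e, e \in edges G -> forall i, (i < nelt T e)%N ->
    exists2 p : {poly R}, (size p <= k.+1)%N &
      forall x, element e i x -> u e x = p.[x].

Definition Vh u : Prop := Pk 1 u /\ H0div u.

Definition Qh u : Prop := Pk 0 u.

Definition pos u : Prop :=
  forall e, e \in edges G -> forall i, (i < nelt T e)%N ->
    forall x, element e i x -> 0 < u e x.

Variables (a b c : vertex G * vertex G -> R) (gamma tau : R).

Definition Pe (e : vertex G * vertex G) (r : R) : R :=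
  c e / (gamma - 1) * r `^ gamma.

Definition P u : netfun G := fun e x => Pe e (u e x).

Definition P' u : netfun G := fun e x => derive1 (Pe e) (u e x).

Definition bd (d : nat -> netfun G) (n : nat) : netfun G :=
  fun e x => (d n e x - d n.-1 e x) / tau.

Definition continuity_eq (rho m : nat -> netfun G) (n : nat) : Prop :=
  forall q, Qh q -> ipE (bd rho n) q = - ipE (dx (m n)) q.

Definition momentum_eq (rho m : nat -> netfun G) (n : nat) : Prop :=
  forall v, Vh v ->
    ipE (fun e x => (rho n.-1 e x)^-1 * bd m n e x
                    - m n e x / (2 * `|rho n e x| ^+ 2) * bd rho n e x) v
    = ipE (fun e x => `|m n e x| ^+ 2 / (2 * `|rho n e x| ^+ 2)
                      + P' (rho n) e x
                      - a e / `|rho n e x| ^+ 2 * dx (m n) e x) (dx v)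
      - ipE (fun e x => m n e x / (2 * `|rho n e x| ^+ 2) * dx (m n) e x) v
      - ipE (fun e x => b e * (`|m n e x| * m n e x / `|rho n e x| ^+ 2)) v.

Definition discrete_solution (rho0 m0 : netfun G) (rho m : nat -> netfun G)
    : Prop :=
  [/\ rho 0%N = rho0, m 0%N = m0 &
      forall n, (1 <= n)%N ->
        [/\ Qh (rho n), Vh (m n), pos (rho n),
            continuity_eq rho m n & momentum_eq rho m n]].

Definition energy (rho m : netfun G) : R :=
  intE (fun e x => `|m e x| ^+ 2 / (2 * rho e x) + P rho e x).

Definition dissipation (rho m : netfun G) : R :=
  intE (fun e x => a e * (`|dx m e x| ^+ 2 / `|rho e x| ^+ 2)
                   + b e * (`|m e x| ^+ 3 / `|rho e x| ^+ 2)).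

End Network.

(* Main.v *)
Require Import Defs.
From mathcomp Require Import all_boot all_order all_algebra.
From mathcomp Require Import all_classical all_reals all_analysis.
From mathcomp Require Import measurable_realfun ring lra.

(* Testing the continuity equation with 1 conserves the mass, since the boundary
   terms of m cancel at the vertices.  For the energy, test the momentum equation
   with m^n and the continuity equation with P'(rho^n), which is piecewise
   constant because rho^n is; on adding the two, the terms in P' cancel.  In the
   energy difference the tangent inequality for the convex P costs
   P'(rho^n) (rho^n - rho^(n-1)), and convexity of 1/rho together with
   |m - w|^2 >= 0 bounds the kinetic part by exactly the tested time
   derivative. *)

Set Implicit Arguments.
Unset Strict Implicit.
Unset Printing Implicit Defensive.

Import Order.TTheory GRing.Theory Num.Theory.
Import numFieldNormedType.Exports.

Local Open Scope classical_set_scope.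
Local Open Scope ring_scope.

(** * Piecewise continuous functions on a partitioned interval *)

Section PiecewiseContinuous.
Context {R : realType}.
Implicit Types (t : nat -> R) (N : nat) (u v : R -> R).
Notation mu := (@lebesgue_measure R).

(** Agreement on each open piece with a function continuous on the whole line rules out blow-up at
    the nodes. The values at the nodes stay arbitrary, so the classical derivative of a piecewise
    affine function qualifies. *)
Definition pw_continuous t N u : Prop :=
  forall i, (i < N)%N ->
    exists2 g : R -> R, continuous g &
      forall x, t i < x < t i.+1 -> u x = g x.

Lemma pw_continuousW t N N' u : (N' <= N)%N ->
  pw_continuous t N u -> pw_continuous t N' u.
Proof. by move=> NN pu i iN; apply: pu; exact: leq_trans NN. Qed.

Lemma pw_continuousD t N u v : pw_continuous t N u -> pw_continuous t N v ->
  pw_continuous t N (fun x => u x + v x).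
Proof.
move=> pu pv i iN; have [g cg ug] := pu i iN; have [h ch vh] := pv i iN.
exists (fun x => g x + h x) => [x|x xi]; first exact: (cvgD (cg x) (ch x)).
by rewrite ug ?vh.
Qed.

Lemma pw_continuousM t N u v : pw_continuous t N u -> pw_continuous t N v ->
  pw_continuous t N (fun x => u x * v x).
Proof.
move=> pu pv i iN; have [g cg ug] := pu i iN; have [h ch vh] := pv i iN.
exists (fun x => g x * h x) => [x|x xi]; first exact: (cvgM (cg x) (ch x)).
by rewrite ug ?vh.
Qed.

Lemma pw_continuous_norm t N u : pw_continuous t N u ->
  pw_continuous t N (fun x => `|u x|).
Proof.
move=> pu i iN; have [g cg ug] := pu i iN.
exists (fun x => `|g x|) => [x|x xi]; last by rewrite ug.
exact: (cvg_norm (cg x)).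
Qed.

Lemma itv_cat_oo_set1 (a b c : R) : a <= b -> b < c ->
  `[a, c]%classic = `[a, b] `|` (`]b, c[ `|` [set c]).
Proof.
move=> ab bc; apply/seteqP; split=> x /=; rewrite !in_itv/=.
  move=> /andP[ax]; rewrite le_eqVlt => /predU1P[->|xc]; first by right; right.
  by have [xb|bx] := leP x b; [left; rewrite ax|right; left; rewrite xc].
by move=> [/andP[->]/=|[/andP[bx xc]|->]]; lra.
Qed.

(** Induction on the number of pieces: the last open piece inherits measurability from [g], and
    boundedness from the compactness of its closure; its right node is treated as a singleton. *)
Lemma pw_continuous_bounded_measurable t N u :
  {homo t : i j / (i < j)%N >-> i < j} ->
  pw_continuous t N u ->
  measurable_fun `[t 0%N, t N] u /\
  exists M, forall x, x \in `[t 0%N, t N] -> `|u x| <= M.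
Proof.
move=> tlt; have tle := ltW_homo tlt.
elim: N => [_|N IH pu].
  rewrite set_itv1; split; first exact: measurable_fun_set1.
  by exists `|u (t 0%N)| => x; rewrite in_itv/= => /le_anti->.
have [mu0 [M uM]] := IH (pw_continuousW (leqnSn _) pu).
have [g cg ug] := pu N (ltnSn N).
have t0N : t 0%N <= t N by exact: tle.
have tNN : t N < t N.+1 by exact: tlt.
split.
  rewrite (itv_cat_oo_set1 t0N tNN).
  apply/measurable_funU => //; first exact: measurableU.
  split=> //; apply/measurable_funU => //; split; last exact: measurable_fun_set1.
  apply: (@eq_measurable_fun _ _ _ _ _ g) => [x|].
    by rewrite inE/= in_itv/= => /ug.
  by apply: measurable_funTS; exact: continuous_measurable_fun.
have [M' [_ gM]] : bounded_set (g @` `[t N, t N.+1]).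
  apply: compact_bounded; apply: continuous_compact; last exact: segment_compact.
  exact: continuous_subspaceT.
(* [bounded_set] provides bounds only strictly above [M'], hence the shift by 1. *)
have {}gM x : x \in `[t N, t N.+1] -> `|g x| <= M' + 1.
  by move=> xI; apply: (gM (M' + 1)); [rewrite ltrDl|exists x].
exists (Num.max M (Num.max (M' + 1) `|u (t N.+1)|)) => x.
rewrite in_itv/= => /andP[x0]; rewrite !le_max.
rewrite le_eqVlt => /predU1P[->|xN1]; first by rewrite lexx !orbT.
have [xN|xN] := leP x (t N); first by rewrite uM// in_itv/= x0.
by rewrite ug ?xN// gM ?orbT// in_itv/= (ltW xN) ltW.
Qed.

Lemma pw_continuous_integrable t N u : {homo t : i j / (i < j)%N >-> i < j} ->
  pw_continuous t N u -> mu.-integrable `[t 0%N, t N] (EFin \o u).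
Proof.
move=> tlt pu; have [mfu [M uM]] := pw_continuous_bounded_measurable tlt pu.
apply: measurable_bounded_integrable => //.
  rewrite /= lebesgue_measure_itv/=; case: ifPn => _; last exact: ltry.
  exact: ltry.
exists M; split; [exact: num_real|move=> y My x /= xI].
exact: le_trans (uM x xI) (ltW My).
Qed.

(** Finiteness of the norm reduces to integrability of [u * u], which is again piecewise
    continuous. *)
Lemma pw_continuous_L2 t N u : {homo t : i j / (i < j)%N >-> i < j} ->
  t 0%N = 0 -> pw_continuous t N u -> L2 (t N) u.
Proof.
move=> tlt t0 pu; have [mfu _] := pw_continuous_bounded_measurable tlt pu.
have := pw_continuous_integrable tlt (pw_continuousM pu pu).
rewrite t0 in mfu * => iu2.
rewrite /L2 inE; apply/andP; split; rewrite inE/=.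
  by apply/measurable_restrict => //; rewrite setTI.
rewrite /finite_norm unlock/= ?pnatr_eq0/=.
apply: poweR_lty.
have /integrable_mkcond/integrableP[//|_] := iu2.
apply: le_lt_trans; rewrite le_eqVlt; apply/orP; left; apply/eqP.
apply: eq_integral => x _; rewrite /patch/=; case: ifP => _.
  by rewrite powR_mulrn// -expr2 -normrX.
by rewrite (normr0 R) powR0 ?pnatr_eq0// abse0.
Qed.

(** The last piece is taken open because [u] is controlled only there; the node has measure zero. *)
Lemma Rintegral_pw_continuous_recr t N u : {homo t : i j / (i < j)%N >-> i < j} ->
  pw_continuous t N.+1 u ->
  \int[mu]_(x in `[t 0%N, t N.+1]) u x =
  \int[mu]_(x in `[t 0%N, t N]) u x + \int[mu]_(x in `]t N, t N.+1[) u x.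
Proof.
move=> tlt pu; have iu := pw_continuous_integrable tlt pu.
have tle := ltW_homo tlt.
have mfu : measurable_fun `]t N, t N.+1[ (EFin \o u).
  apply: (measurable_funS _ _ (measurable_int _ iu)) => //.
  by apply: subset_itv; rewrite bnd_simp// tle.
have -> : \int[mu]_(x in `]t N, t N.+1[) u x = \int[mu]_(x in `]t N, t N.+1]) u x.
  by rewrite /Rintegral [in RHS]integral_itv_bndoo.
rewrite -(Rintegral_itvB iu (x := t N)) ?bnd_simp ?tle//.
by rewrite addrCA subrr addr0.
Qed.

Lemma Rintegral_pw_continuous_ge0 t N u : {homo t : i j / (i < j)%N >-> i < j} ->
  pw_continuous t N u ->
  (forall i, (i < N)%N -> forall x, t i < x < t i.+1 -> 0 <= u x) ->
  0 <= \int[mu]_(x in `[t 0%N, t N]) u x.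
Proof.
move=> tlt; elim: N => [_ _|N IH pu u0]; first by rewrite set_itv1 Rintegral_set1.
rewrite Rintegral_pw_continuous_recr// addr_ge0//.
  by apply: IH => [|i iN]; [exact: pw_continuousW pu|exact/u0/ltnW].
by apply: Rintegral_ge0 => x/=; rewrite in_itv/=; exact: u0.
Qed.

(** Differentiation is local, so on the open interval [u] may be replaced by [p], whose derivative
    is a constant polynomial. *)
Lemma derive1_affine (a b : R) u (p : {poly R}) : (size p <= 2)%N ->
  (forall x, a < x < b -> u x = p.[x]) ->
  forall x, a < x < b -> derive1 u x = p`_1.
Proof.
move=> sp up x xab.
rewrite derive1E (@near_eq_derive _ _ _ _ (horner p)); last first.
  have : x \in `]a, b[ by rewrite in_itv.
  by move=> /near_in_itvoo; apply: filterS => y; rewrite in_itv/=; exact: up.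
rewrite -derive1E -derivE.
have sp' : (size p^`() <= 1)%N.
  by rewrite (leq_trans (size_poly _ _))//; case: (size p) sp => [|[|[]]].
by rewrite (horner_coef_wide _ sp') big_ord1 expr0 mulr1 coef_deriv.
Qed.

(** On each piece the slope times the length is the increment of the polynomial. Continuity of [u]
    at the nodes makes these increments telescope. *)
Lemma Rintegral_derive1_pw_affine t N u :
  {homo t : i j / (i < j)%N >-> i < j} ->
  {within `[t 0%N, t N], continuous u} ->
  (forall i, (i < N)%N -> exists2 p : {poly R}, (size p <= 2)%N &
     forall x, t i < x < t i.+1 -> u x = p.[x]) ->
  \int[mu]_(x in `[t 0%N, t N]) derive1 u x = u (t N) - u (t 0%N).
Proof.
move=> tlt; have tle := ltW_homo tlt.
elim: N => [_ _|N IH cu pu]; first by rewrite set_itv1 Rintegral_set1 subrr.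
have pdu : pw_continuous t N.+1 (derive1 u).
  move=> i /pu[p sp /(derive1_affine sp) us].
  by exists (cst p`_1) => [x|x /us//]; exact: cst_continuous.
rewrite Rintegral_pw_continuous_recr// IH; last 2 first.
- apply: continuous_subspaceW cu; apply: subset_itvl; rewrite bnd_simp.
  exact: tle.
- by move=> i iN; exact/pu/ltnW.
have [p sp up] := pu N (ltnSn N).
have tNN : t N < t N.+1 by exact: tlt.
have /(continuous_within_itvP _ tNN)[_ uN uN1] :
    {within `[t N, t N.+1], continuous u}.
  apply: continuous_subspaceW cu; apply: subset_itvr; rewrite bnd_simp.
  exact: tle.
(* The polynomial represents [u] only inside the piece; the end values are recovered as one-sided
   limits. *)
have -> : u (t N) = p.[t N].
  apply: (cvg_unique _ uN); first exact: Rhausdorff.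
  have : p.[x] @[x --> (t N)^'+] --> p.[t N].
    by apply: cvg_at_right_filter; exact: continuous_horner.
  apply: cvg_trans; apply: near_eq_cvg; near=> x; symmetry; apply: up.
  by apply/andP; split; near: x; [exact: nbhs_right_gt|exact: nbhs_right_lt].
have -> : u (t N.+1) = p.[t N.+1].
  apply: (cvg_unique _ uN1); first exact: Rhausdorff.
  have : p.[x] @[x --> (t N.+1)^'-] --> p.[t N.+1].
    by apply: cvg_at_left_filter; exact: continuous_horner.
  apply: cvg_trans; apply: near_eq_cvg; near=> x; symmetry; apply: up.
  by apply/andP; split; near: x; [exact: nbhs_left_gt|exact: nbhs_left_lt].
rewrite (@eq_Rintegral _ _ _ _ _ (cst p`_1)); last first.
  by move=> x; rewrite inE/= in_itv/= => /(derive1_affine sp up).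
rewrite Rintegral_cst//= lebesgue_measure_itv/= lte_fin tNN -EFinB/=.
rewrite !(horner_coef_wide _ sp) !big_ord_recl !big_ord0/=.
rewrite !expr0 !expr1 /bump/= !addn0; ring.
Unshelve. all: by end_near. Qed.

End PiecewiseContinuous.

(** * Integration over the network and the finite element spaces *)

Section Network.
Context {R : realType} (G : network R) (T : mesh G).
Implicit Types u v : netfun G.

Definition pw_continuousE u : Prop :=
  forall e, e \in edges G -> pw_continuous (node T e) (nelt T e) (u e).

Definition pw_constantE u : Prop :=
  forall e, e \in edges G -> forall i, (i < nelt T e)%N ->
    exists c : R, forall x, element T e i x -> u e x = c.

Lemma node_lt e : e \in edges G -> {homo node T e : i j / (i < j)%N >-> i < j}.
Proof.
move=> eG i j ij; rewrite /node ltr_pM2r ?ltr_nat// divr_gt0 ?len_gt0//.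
by rewrite ltr0n (nelt_gt0 T eG).
Qed.

Lemma node0 e : node T e 0 = 0.
Proof. by rewrite /node mul0r. Qed.

Lemma node_nelt e : e \in edges G -> node T e (nelt T e) = len e.
Proof.
by move=> eG; rewrite /node mulrC divfK// pnatr_eq0 -lt0n (nelt_gt0 T eG).
Qed.

Lemma edge_itv e : e \in edges G ->
  `[0, len e]%classic = `[node T e 0, node T e (nelt T e)]%classic.
Proof. by move=> eG; rewrite node0 node_nelt. Qed.

Lemma elementP e i x : element T e i x <-> node T e i < x < node T e i.+1.
Proof. by rewrite /element/= in_itv. Qed.

Lemma pw_constantE_continuous u : pw_constantE u -> pw_continuousE u.
Proof.
move=> cu e eG i iN; have [c uc] := cu e eG i iN.
by exists (cst c) => [x|x /elementP /uc//]; exact: cst_continuous.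
Qed.

(** Since [F] is arbitrary, this covers reciprocals of the density as well as [P] and [P']. In
    particular it makes [P'] of a discrete density an admissible test function. *)
Lemma pw_constantE_comp (F : vertex G * vertex G -> R -> R) u :
  pw_constantE u -> pw_constantE (fun e x => F e (u e x)).
Proof.
move=> cu e eG i iN; have [c uc] := cu e eG i iN.
by exists (F e c) => x /uc ->.
Qed.

Lemma pw_continuousE_cst (f : vertex G * vertex G -> R) :
  pw_continuousE (fun e _ => f e).
Proof. by apply: pw_constantE_continuous => e eG i iN; exists (f e). Qed.

Lemma pw_continuousED u v : pw_continuousE u -> pw_continuousE v ->
  pw_continuousE (fun e x => u e x + v e x).
Proof. by move=> pu pv e eG; apply: pw_continuousD; [exact: pu|exact: pv]. Qed.

Lemma pw_continuousEM u v : pw_continuousE u -> pw_continuousE v ->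
  pw_continuousE (fun e x => u e x * v e x).
Proof. by move=> pu pv e eG; apply: pw_continuousM; [exact: pu|exact: pv]. Qed.

Lemma pw_continuousEB u v : pw_continuousE u -> pw_continuousE v ->
  pw_continuousE (fun e x => u e x - v e x).
Proof.
move=> pu pv; apply: pw_continuousED => // e eG i iN.
have [g cg vg] := pv e eG i iN.
exists (fun x => - g x) => [x|x xi]; first exact: (cvgN (cg x)).
by rewrite vg.
Qed.

Lemma pw_continuousE_norm u : pw_continuousE u ->
  pw_continuousE (fun e x => `|u e x|).
Proof. by move=> pu e eG; apply: pw_continuous_norm; exact: pu. Qed.

Lemma pw_continuousEX n u : pw_continuousE u ->
  pw_continuousE (fun e x => u e x ^+ n).
Proof.
move=> pu; elim: n => [|n IH]; first exact: pw_continuousE_cst.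
have := pw_continuousEM pu IH; congr pw_continuousE.
by apply/funext => e; apply/funext => x; rewrite exprS.
Qed.

Lemma pw_continuousE_integrable u e : pw_continuousE u -> e \in edges G ->
  (@lebesgue_measure R).-integrable `[0, len e] (EFin \o u e).
Proof.
move=> pu eG; rewrite edge_itv//.
by apply: pw_continuous_integrable; [exact: node_lt|exact: pu].
Qed.

Lemma pw_continuousE_L2E u : pw_continuousE u -> L2E u.
Proof.
move=> pu e eG; rewrite -(node_nelt eG).
by apply: pw_continuous_L2; [exact: node_lt|exact: node0|exact: pu].
Qed.

Lemma intED u v : pw_continuousE u -> pw_continuousE v ->
  intE (fun e x => u e x + v e x) = intE u + intE v.
Proof.
move=> pu pv; rewrite /intE -big_split/=; apply: eq_bigr => e eG.
by apply: RintegralD => //; exact: pw_continuousE_integrable.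
Qed.

Lemma intEB u v : pw_continuousE u -> pw_continuousE v ->
  intE (fun e x => u e x - v e x) = intE u - intE v.
Proof.
move=> pu pv; rewrite /intE -sumrB; apply: eq_bigr => e eG.
by apply: RintegralB => //; exact: pw_continuousE_integrable.
Qed.

Lemma intEZ k u : pw_continuousE u -> intE (fun e x => k * u e x) = k * intE u.
Proof.
move=> pu; rewrite /intE mulr_sumr; apply: eq_bigr => e eG.
by apply: RintegralZl => //; exact: pw_continuousE_integrable.
Qed.

(** Comparison on the open elements is what the discrete data allow: positivity of the density is
    known only there. *)
Lemma le_intE u v : pw_continuousE u -> pw_continuousE v ->
  (forall e, e \in edges G -> forall i, (i < nelt T e)%N ->
     forall x, element T e i x -> u e x <= v e x) ->
  intE u <= intE v.
Proof.
move=> pu pv uv; rewrite -subr_ge0 -intEB//; apply: sumr_ge0 => e eG.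
rewrite edge_itv//; apply: Rintegral_pw_continuous_ge0.
- exact: node_lt.
- exact: pw_continuousEB.
- by move=> i iN x /elementP xi; rewrite subr_ge0 (uv _ eG _ iN).
Qed.

Lemma Qh_pw_constant u : Qh T u <-> pw_constantE u.
Proof.
split=> [[_ pu] e eG i iN|cu].
  have [p sp up] := pu e eG i iN; exists p`_0 => x /up ->.
  by rewrite (horner_coef_wide _ sp) big_ord1 expr0 mulr1.
split; first exact/pw_continuousE_L2E/pw_constantE_continuous.
move=> e eG i iN; have [c uc] := cu e eG i iN.
by exists c%:P => [|x /uc ->]; rewrite ?size_polyC ?leq_b1 ?hornerC.
Qed.

Lemma Vh_pw_continuous u : Vh T u -> pw_continuousE u.
Proof.
move=> [[_ pu] _] e eG i iN; have [p sp up] := pu e eG i iN.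
by exists (horner p) => [|x /elementP]; [exact: continuous_horner|exact: up].
Qed.

Lemma Vh_dx_pw_constant u : Vh T u -> pw_constantE (dx u).
Proof.
move=> [[_ pu] _] e eG i iN; have [p sp up] := pu e eG i iN.
exists p`_1 => x /elementP; apply: (derive1_affine sp) => y /elementP.
exact: up.
Qed.

(** Each edge contributes the difference of its end values; regrouped by vertex, these are the flux
    balances that [H0div] sets to zero. *)
Lemma intE_dx u : Vh T u -> intE (dx u) = 0.
Proof.
move=> [[_ pu] [hu divu]].
have -> : intE (dx u) = \sum_(e in edges G) (u e (len e) - u e 0).
  apply: eq_bigr => e eG; rewrite edge_itv// -[in RHS](node0 e) -(node_nelt eG).
  apply: Rintegral_derive1_pw_affine.
  - exact: node_lt.
  - by rewrite node0 node_nelt//; have [] := hu e eG.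
  - move=> i iN; have [p sp up] := pu e eG i iN.
    by exists p => // x /elementP; exact: up.
(* Every edge has exactly one head and one tail, so summing over vertices counts each end value
   once, also for loops. *)
transitivity (\sum_(v : vertex G) (\sum_(e in edges G | e.2 == v) u e (len e)
      - \sum_(e in edges G | e.1 == v) u e 0)); last by apply: big1 => v _.
by rewrite !sumrB -!partition_big.
Qed.

End Network.

(** * Tangent inequality for real powers *)

Lemma powR_bernoulli (R : realType) (g x : R) : 1 < g -> 0 <= x ->
  1 + g * (x - 1) <= x `^ g.
Proof.
move=> g1 x0; have g0 : 0 < g by lra.
have q0 : 0 < 1 - g^-1 by rewrite subr_gt0 invf_lt1.
(* Young's inequality for the product of [x] and 1, with conjugate exponents [g] and
   [(1 - g^-1)^-1]; multiplying by [g] gives the claim. *)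
have := @conjugate_powR R x 1 g (1 - g^-1)^-1 x0 ler01 g0.
rewrite invr_gt0 invrK subrKC powR1 mulr1 => /(_ q0 erefl).
rewrite mul1r -(ler_pM2r g0) mulrDl divfK ?gt_eqF// mulrBl mulVf ?gt_eqF//.
lra.
Qed.

(** Bernoulli's inequality at [s / r], scaled by [r] to the power [g]. *)
Lemma powR_tangent (R : realType) (g r s : R) : 1 < g -> 0 < r -> 0 < s ->
  r `^ g + g * r `^ (g - 1) * (s - r) <= s `^ g.
Proof.
move=> g1 r0 s0.
have sr0 : 0 <= s / r by rewrite divr_ge0 ?ltW.
have := powR_bernoulli g1 sr0.
rewrite -(ler_pM2l (powR_gt0 g r0)) -powRM ?(ltW r0)// mulrCA divff ?gt_eqF// mulr1.
apply: le_trans; rewrite -mulr_powRB1 ?(ltW r0)//; last lra.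
by rewrite le_eqVlt; apply/orP; left; apply/eqP; field; rewrite gt_eqF.
Qed.

(** * Mass and energy balance over one time step *)

Section Step.
Context {R : realType} (G : network R) (T : mesh G).
Variables (a b c : vertex G * vertex G -> R) (gamma tau : R).
Hypotheses (c_gt0 : forall e, e \in edges G -> 0 < c e) (gamma_gt1 : 1 < gamma).
Hypothesis tau_gt0 : 0 < tau.

Lemma Pe_tangent e (r s : R) : e \in edges G -> 0 < r -> 0 < s ->
  Pe c gamma e r - Pe c gamma e s <= derive1 (Pe c gamma e) r * (r - s).
Proof.
move=> eG r0 s0.
have -> : derive1 (Pe c gamma e) r = c e / (gamma - 1) * (gamma * r `^ (gamma - 1)).
  rewrite derive1E.
  exact: (@derive_val _ _ _ _ _ _ _
    (is_deriveZ (c e / (gamma - 1)) (is_derive1_powR gamma r0))).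
have k0 : 0 <= c e / (gamma - 1).
  by rewrite divr_ge0 ?(ltW (c_gt0 eG))// subr_ge0 ltW.
have := powR_tangent gamma_gt1 r0 s0.
rewrite /Pe; move: (c e / _) k0 => k k0 /(ler_wpM2l k0); lra.
Qed.

(** The gap is an explicit sum of two nonnegative terms: a square from changing the momentum at the
    old density [s], and the convexity defect of the reciprocal between [r] and [s]. The right side
    has the weights of the scheme: the old density under the momentum difference, the new one under
    the density difference. *)
Lemma kinetic_tangent (r s m w : R) : 0 < r -> 0 < s ->
  m ^+ 2 / (2 * r) - w ^+ 2 / (2 * s)
  <= (m - w) * m / s - m ^+ 2 * (r - s) / (2 * r ^+ 2).
Proof.
move=> r0 s0; rewrite -subr_ge0.
have -> : (m - w) * m / s - m ^+ 2 * (r - s) / (2 * r ^+ 2)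
    - (m ^+ 2 / (2 * r) - w ^+ 2 / (2 * s))
  = (m - w) ^+ 2 / (2 * s) + m ^+ 2 * (r - s) ^+ 2 / (2 * r ^+ 2 * s).
  by field; rewrite !gt_eqF.
rewrite addr_ge0// divr_ge0//.
- exact: sqr_ge0.
- by rewrite mulr_ge0// ltW.
- by rewrite mulr_ge0 ?sqr_ge0.
- by rewrite !mulr_ge0 ?sqr_ge0// ltW.
Qed.

Variables (rho m : nat -> netfun G) (n : nat).
Hypotheses (rho_Qh : Qh T (rho n.+1)) (rho_Qh' : Qh T (rho n)).
Hypotheses (rho_pos : pos T (rho n.+1)) (rho_pos' : pos T (rho n)).
Hypotheses (m_Vh : Vh T (m n.+1)) (m_Vh' : Vh T (m n)).
Hypothesis cont : continuity_eq T tau rho m n.+1.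
Hypothesis mom : momentum_eq T a b c gamma tau rho m n.+1.

Lemma mass_step : intE (rho n.+1) = intE (rho n).
Proof.
have /pw_constantE_continuous pr := iffLR (Qh_pw_constant T _) rho_Qh.
have /pw_constantE_continuous pr' := iffLR (Qh_pw_constant T _) rho_Qh'.
have q1 : Qh T (fun _ _ => 1) by apply/Qh_pw_constant => e eG i iN; exists 1.
have := cont q1.
have -> : ipE (bd tau rho n.+1) (fun _ _ => 1) =
    intE (fun e x => tau^-1 * (rho n.+1 e x - rho n e x)).
  by congr intE; apply/funext => e; apply/funext => x; rewrite mulr1 mulrC.
have -> : ipE (dx (m n.+1)) (fun _ _ => 1) = intE (dx (m n.+1)).
  by congr intE; apply/funext => e; apply/funext => x; rewrite mulr1.
rewrite (intE_dx m_Vh) oppr0 (intEZ _ (pw_continuousEB pr pr')) (intEB pr pr').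
by move=> /eqP; rewrite mulf_eq0 invr_eq0 gt_eqF//= subr_eq0 => /eqP.
Qed.

(** With [m n.+1] as test function, the two transport terms, both half of m^2 dx m / rho^2, cancel,
    while the viscous and friction terms become the dissipation. *)
Lemma energy_step :
  energy c gamma (rho n.+1) (m n.+1)
    + tau * dissipation a b (rho n.+1) (m n.+1)
  <= energy c gamma (rho n) (m n).
Proof.
have cr := iffLR (Qh_pw_constant T _) rho_Qh.
have cr' := iffLR (Qh_pw_constant T _) rho_Qh'.
have pr := pw_constantE_continuous cr.
have pr' := pw_constantE_continuous cr'.
have pm := Vh_pw_continuous m_Vh.
have pm' := Vh_pw_continuous m_Vh'.
have cd := Vh_dx_pw_constant m_Vh.
have pd := pw_constantE_continuous cd.
have cP' : pw_constantE T (P' c gamma (rho n.+1)).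
  exact: (pw_constantE_comp (fun e r => derive1 (Pe c gamma e) r) cr).
have pP' := pw_constantE_continuous cP'.
have pP : pw_continuousE T (P c gamma (rho n.+1)).
  exact: (pw_constantE_continuous (pw_constantE_comp (Pe c gamma) cr)).
have pP0 : pw_continuousE T (P c gamma (rho n)).
  exact: (pw_constantE_continuous (pw_constantE_comp (Pe c gamma) cr')).
have pF (F : R -> R) : pw_continuousE T (fun e x => F (rho n.+1 e x)).
  exact: (pw_constantE_continuous (pw_constantE_comp (fun=> F) cr)).
have pF' (F : R -> R) : pw_continuousE T (fun e x => F (rho n e x)).
  exact: (pw_constantE_continuous (pw_constantE_comp (fun=> F) cr')).
have pa := @pw_continuousE_cst _ _ T a.
have pb := @pw_continuousE_cst _ _ T b.
have pt := @pw_continuousE_cst _ _ T (fun=> tau^-1).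
have pbr : pw_continuousE T (bd tau rho n.+1).
  by apply: pw_continuousEM => //; exact: pw_continuousEB.
have pbm : pw_continuousE T (bd tau m n.+1).
  by apply: pw_continuousEM => //; exact: pw_continuousEB.
pose r2 := pF (fun r => (`|r| ^+ 2)^-1).
pose r22 := pF (fun r => (2 * `|r| ^+ 2)^-1).
(* [pL], [pA], [pB] and [pC] mirror the tested integrands of the momentum equation (time derivative,
   flux, transport, friction), so that linearity of the integral applies by rewriting. *)
have pL := pw_continuousEM (pw_continuousEB
  (pw_continuousEM (pF' GRing.inv) pbm)
  (pw_continuousEM (pw_continuousEM pm r22) pbr)) pm.
have pA := pw_continuousEM (pw_continuousEB (pw_continuousED
  (pw_continuousEM (pw_continuousEX 2 (pw_continuousE_norm pm)) r22) pP')
  (pw_continuousEM (pw_continuousEM pa r2) pd)) pd.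
have pB := pw_continuousEM (pw_continuousEM (pw_continuousEM pm r22) pd) pm.
have pC := pw_continuousEM (pw_continuousEM pb (pw_continuousEM (pw_continuousEM
  (pw_continuousE_norm pm) pm) r2)) pm.
have pQ1 := pw_continuousEM pbr pP'.
have pQ2 := pw_continuousEM pd pP'.
have pE := pw_continuousED (pw_continuousEM
  (pw_continuousEX 2 (pw_continuousE_norm pm)) (pF (fun r => (2 * r)^-1))) pP.
have pE' := pw_continuousED (pw_continuousEM
  (pw_continuousEX 2 (pw_continuousE_norm pm')) (pF' (fun r => (2 * r)^-1))) pP0.
have pD := pw_continuousED
  (pw_continuousEM pa (pw_continuousEM (pw_continuousEX 2 (pw_continuousE_norm pd)) r2))
  (pw_continuousEM pb (pw_continuousEM (pw_continuousEX 3 (pw_continuousE_norm pm)) r2)).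
have /eqP := mom m_Vh; rewrite -subr_eq0 => /eqP momE.
have /eqP := cont (iffRL (Qh_pw_constant T _) cP'); rewrite -addr_eq0 => /eqP contE.
(* [rhsE] writes 0 as tau times the integral of a single function that dominates
   the rate of energy change plus the dissipation pointwise on each element. *)
have rhsE := f_equal2 (fun x y => tau * (x + y)) momE contE.
rewrite /ipE opprB opprB !addr0 mulr0 !addrA /= in rhsE.
have pLC := pw_continuousED pL pC; have pLCB := pw_continuousED pLC pB.
have pLCBA := pw_continuousEB pLCB pA.
have pQ := pw_continuousED pLCBA pQ1; have pZ := pw_continuousED pQ pQ2.
rewrite -(intED pL pC) -(intED pLC pB) -(intEB pLCB pA) -(intED pLCBA pQ1)
  -(intED pQ pQ2) -(intEZ tau pZ) in rhsE.
have ptD := pw_continuousEM (@pw_continuousE_cst _ _ T (fun=> tau)) pD.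
have ptZ := pw_continuousEM (@pw_continuousE_cst _ _ T (fun=> tau)) pZ.
have pED := pw_continuousED pE ptD.
rewrite -subr_le0 -rhsE /energy /dissipation -(intEZ tau pD) -(intED pE ptD).
rewrite -(intEB pED pE'); apply: (le_intE (pw_continuousEB pED pE') ptZ).
move=> e eG i iN x xi /=.
have r0 := rho_pos eG iN xi; have s0 := rho_pos' eG iN xi.
rewrite /bd /P /P' /=.
move: (m n e x) (m n.+1 e x) (dx (m n.+1) e x) => w v d.
move: (rho n e x) (rho n.+1 e x) s0 r0 => s r s0 r0.
have := Pe_tangent eG r0 s0; have := kinetic_tangent v w r0 s0.
move: (Pe c gamma e r) (Pe c gamma e s) (derive1 (Pe c gamma e) r) => Pr Ps dP.
rewrite !exprSr !expr0 !mul1r (gtr0_norm r0).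
have normM (z : R) : `|z| * `|z| = z * z by rewrite -!expr2 real_normK ?num_real.
(* Only one absolute value survives, the odd factor of the cubic friction term; it is treated as an
   independent real [nv]. *)
rewrite !normM; move: `|v| (dP : R) => nv {}dP hk hp.
(* The transport terms and the products [dP * d] drop out, leaving the upper bounds in [hk] and [hp]
   plus [tau] times the dissipation density. *)
have -> : tau *
  ((s^-1 * ((v - w) / tau) - v / (2 * (r * r)) * ((r - s) / tau)) * v +
   b e * (nv * v / (r * r)) * v + v / (2 * (r * r)) * d * v -
   (v * v / (2 * (r * r)) + dP - a e / (r * r) * d) * d +
   (r - s) / tau * dP + d * dP)
  = (v - w) * v / s - v * v * (r - s) / (2 * (r * r)) + dP * (r - s)
    + tau * (a e * (d * d / (r * r)) + b e * (v * v * nv / (r * r))).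
  by field; rewrite !gt_eqF.
lra.
Qed.

End Step.

(** * Induction over the time steps *)

Theorem lemma5p2 (R : realType) (G : network R) (T : mesh G)
    (a b c : vertex G * vertex G -> R) (gamma tau : R)
    (a_ge0 : forall e, e \in edges G -> 0 <= a e)
    (b_ge0 : forall e, e \in edges G -> 0 <= b e)
    (c_gt0 : forall e, e \in edges G -> 0 < c e)
    (gamma_gt1 : 1 < gamma) (tau_gt0 : 0 < tau)
    (rho0 m0 : netfun G)
    (rho0_Qh : Qh T rho0) (rho0_gt0 : pos T rho0) (m0_Vh : Vh T m0)
    (rho m : nat -> netfun G)
    (sol : discrete_solution T a b c gamma tau rho0 m0 rho m) (n : nat) :
  intE (rho n) = intE rho0 /\
  energy c gamma (rho n) (m n)
    + tau * (\sum_(1 <= k < n.+1) dissipation a b (rho k) (m k))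
  <= energy c gamma rho0 m0.
Proof.
have [rho_0 m_0 step] := sol.
(* The initial data meet the same conditions as later iterates, so the one-step estimates also cover
   the first step. *)
have adm k : [/\ Qh T (rho k), pos T (rho k) & Vh T (m k)].
  by case: k => [|k]; [rewrite rho_0 m_0|have [] := step k.+1 isT].
elim: n => [|n [IHm IHe]].
  by rewrite rho_0 m_0 big_geq// mulr0 addr0.
have [Qn pn Vn] := adm n; have [QSn VSn pSn cont mom] := step n.+1 isT.
split; first by rewrite -IHm; exact: (mass_step tau_gt0 QSn Qn VSn cont).
have es := energy_step c_gt0 gamma_gt1 tau_gt0 QSn Qn pSn pn VSn Vn cont mom.
rewrite big_nat_recr//= mulrDr; lra.
Qed.
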